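(* A function $A_1:(0,\infty)\to[0,1]$ is the poverty gap ratio relating to a distribution function $F$ if and only if it satisfies the following properties: (a) $\lim_{t\to\infty}\frac{d}{dt}\bigl(tA_1(t)\bigr)=1$ and $\lim_{t\to 0}\frac{d}{dt}\bigl(tA_1(t)\bigr)\ge 0$; (b) $A_1(t)$ is increasing (i.e. non-decreasing) and differentiable; (c) $tA_1(t)$ is convex; (d) $A_1(t)=\int_0^t \frac{t-x}{t}\,dF(x)$.
   Context: $F$ denotes the distribution function of a continuous non-negative random variable $X$ (income), and $t>0$ is the poverty line. The poverty gap ratio of $F$ is the function of $t$ $$A_F(t,1)=\int_0^t\left(1-\frac{x}{t}\right)dF(x),\qquad t>0 .$$ *)

(* Defs.v *)
From HB Require Import structures.
From mathcomp Require Import all_boot all_order all_algebra.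
From mathcomp Require Import all_classical all_reals all_analysis.

Set Implicit Arguments.
Unset Strict Implicit.
Unset Printing Implicit Defensive.

Import Order.TTheory GRing.Theory Num.Theory.
Import numFieldNormedType.Exports.

Local Open Scope classical_set_scope.
Local Open Scope ring_scope.

(* The real-valued F is related to the extended-real-valued [cdf] of X. That F
   is non-decreasing and right-continuous follows from the last clause; it is
   required by the type of F so that the Lebesgue-Stieltjes measure dF exists.
   A continuous random variable is one whose distribution function is
   continuous; it need not have a density. *)
Definition continuous_nonneg_distribution (R : realType) d
    (T : measurableType d) (P : probability T R) (X : {RV P >-> R})
    (F : cumulative R R) : Prop :=
  [/\ {ae P, forall w, 0 <= X w},
      continuous (F : R -> R)
    & forall r : R, cdf X r = (F r)%:E].

(* For a continuous F the endpoints of the interval of integration have no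
   mass, so the choice of [0, t] among the intervals from 0 to t is immaterial;
   the integrand is bounded there, so [Rintegral] does not use its default. *)
Definition poverty_gap_ratio (R : realType) (F : cumulative R R) (t : R) : R :=
  \int[lebesgue_stieltjes_measure F]_(x in `[0, t]) (1 - (x : R) / t).

(* Main.v *)
(* Let G t = t * A1 t = \int_[0, t] (t - x) dF. Since dF [0, s] = F s, splitting
   the larger of two such integrals at the smaller endpoint shows
   F s * (t - s) <= G t - G s for all s, t >= 0: F s is a subgradient of G at s.
   A continuous subgradient is the derivative, so G' = F, which gives (a) and
   differentiability, and G is convex. At t = 0 the inequality gives A1 s <= F s;
   inserting this back gives the monotonicity of A1. *)
Require Import Defs.
From mathcomp Require Import all_boot all_order all_algebra.
From mathcomp Require Import all_classical all_reals all_analysis.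
From mathcomp Require Import unstable measurable_realfun ring lra.

Import Order.TTheory GRing.Theory Num.Theory.
Import numFieldNormedType.Exports.

Local Open Scope classical_set_scope.
Local Open Scope ring_scope.

Lemma nonneg_cdf_lt0 (R : realType) (d : measure_display) (T : measurableType d)
    (P : probability T R) (X : {RV P >-> R}) (r : R) :
  {ae P, forall w, 0 <= X w} -> r < 0 -> cdf X r = 0%E.
Proof.
move=> X0 r0; rewrite /cdf /distribution /pushforward.
apply/negligibleP; first by rewrite -[X in measurable X]setTI; exact: measurable_funPT.
apply: negligibleS X0 => w /=; rewrite in_itv/= => Xr /(le_trans)/(_ Xr).
by rewrite leNgt r0.
Qed.

(** Non-negativity of [X] settles [r < 0]; at [0] continuity makes [F 0] the left limit of zeros, so
    there is no atom at [0]. *)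
Lemma continuous_nonneg_distribution_le0 (R : realType) (d : measure_display)
    (T : measurableType d) (P : probability T R) (X : {RV P >-> R})
    (F : cumulative R R) (r : R) :
  continuous_nonneg_distribution X F -> r <= 0 -> F r = 0.
Proof.
move=> [X0 cF XF].
have Flt0 s : s < 0 -> F s = 0.
  by move=> s0; apply: EFin_inj; rewrite -XF nonneg_cdf_lt0.
rewrite le_eqVlt => /predU1P[->|]; last exact: Flt0.
have F00 : F x @[x --> 0^'-] --> (0 : R).
  by apply: cvg_near_cst; near=> x; rewrite Flt0.
apply: (cvg_unique _ _ F00) => //.
exact: cvg_at_left_filter (cF 0).
Unshelve. all: by end_near. Qed.

Lemma continuous_nonneg_distribution_cvgy (R : realType) (d : measure_display)
    (T : measurableType d) (P : probability T R) (X : {RV P >-> R})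
    (F : cumulative R R) :
  continuous_nonneg_distribution X F -> F x @[x --> +oo] --> (1 : R).
Proof.
move=> [_ _ XF].
have -> : (F : R -> R) = fine \o cdf X by apply/funext => r; rewrite /= XF.
exact/fine_cvg/cvg_cdfy1.
Qed.

Lemma lebesgue_stieltjes_measure_itvoc (R : realType) (F : cumulative R R)
    (a b : R) : a <= b ->
  lebesgue_stieltjes_measure F `]a, b] = (F b - F a)%:E.
Proof.
move=> ab; rewrite /lebesgue_stieltjes_measure /measure_extension/=.
by rewrite measurable_mu_extE/= ?wlength_itv_bnd//; exact: is_ocitv.
Qed.

Lemma lebesgue_stieltjes_measure_itv0c (R : realType) (F : cumulative R R)
    (t : R) : (forall r, r <= 0 -> F r = 0) -> 0 <= t ->
  lebesgue_stieltjes_measure F `[0, t] = (F t)%:E.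
Proof.
(* [0, t] lies between ]0, t] and ]-1, t], which have the same mass. *)
move=> F0 t0; apply/eqP; rewrite eq_le; apply/andP; split.
- have -> : (F t)%:E = lebesgue_stieltjes_measure F `]-1, t].
    rewrite lebesgue_stieltjes_measure_itvoc ?(F0 (-1)) ?subr0//; lra.
  rewrite le_measure ?inE//; try exact: measurable_itv.
  by apply: subset_itv; rewrite bnd_simp//; lra.
- have -> : (F t)%:E = lebesgue_stieltjes_measure F `]0, t].
    by rewrite lebesgue_stieltjes_measure_itvoc ?(F0 0) ?subr0.
  rewrite le_measure ?inE//; try exact: measurable_itv.
  by apply: subset_itv; rewrite bnd_simp.
Qed.

Section Rintegral_sub.
Context {R : realType} (mu : {measure set (measurableTypeR R) -> \bar R}).
(** [H] abstracts the distribution function: the estimates below rest on the masses of the intervals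
    [[0, t]] alone. *)
Variable H : R -> R.
Context (muH : forall t : R, 0 <= t -> mu `[0, t]%classic = (H t)%:E).

(** A bounded function on a set of finite mass. The constant [s] is independent of the endpoint [t]
    because splitting an integral keeps the integrand and changes the interval. *)
Lemma integrable_sub_itv0c (s t : R) : 0 <= t ->
  mu.-integrable `[0, t] (EFin \o (fun x : R => s - x)).
Proof.
move=> t0; apply: measurable_bounded_integrable.
- exact: measurable_itv.
- by rewrite muH// ltry.
- exact: measurable_funB.
- exists (`|s| + t); split; first exact: num_real.
  move=> M sM x /=; rewrite in_itv/= => /andP[x0 xt].
  rewrite (le_trans (ler_normB _ _))// (ger0_norm x0).
  by apply: ltW; apply: le_lt_trans sM; rewrite lerD2l.
Qed.

Lemma itv0c_setU (s t : R) : 0 <= s -> s <= t ->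
  `[0, t]%classic = `[0, s]%classic `|` `]s, t]%classic.
Proof. by move=> s0 st; rewrite -itv_bndbnd_setU// bnd_simp. Qed.

Lemma disj_itv0c_itvoc (s t : R) : [disjoint `[0, s]%classic & `]s, t]%classic].
Proof.
rewrite disj_set2E; apply/eqP; rewrite -subset0 => x [] /=; rewrite !in_itv/=.
by move=> /andP[_ xs] /andP[/lt_le_trans/(_ xs)]; rewrite ltxx.
Qed.

Lemma measure_itvoc_diff (s t : R) : 0 <= s -> s <= t ->
  mu `]s, t]%classic = (H t - H s)%:E.
Proof.
move=> s0 st; have t0 := le_trans s0 st.
have : mu `[0, t]%classic = (mu `[0%R, s]%classic + mu `]s, t]%classic)%E.
  rewrite (itv0c_setU s t s0 st) measureU//; try exact: measurable_itv.
  by apply/eqP; rewrite -disj_set2E; exact: disj_itv0c_itvoc.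
(* An infinite mass of []s, t]] would contradict additivity, as [H t] is finite. *)
rewrite !muH//; case: (mu _) => [r| |]//= [->]; congr EFin; ring.
Qed.

Lemma Rintegral_sub_itv0cD (s t u : R) : 0 <= s -> s <= t ->
  \int[mu]_(x in `[0, t]) (u - x) =
  \int[mu]_(x in `[0, s]) (u - x) + \int[mu]_(x in `]s, t]) (u - x).
Proof.
move=> s0 st; rewrite (itv0c_setU s t s0 st) Rintegral_setU//=.
- by rewrite -itv0c_setU//; apply: integrable_sub_itv0c; exact: le_trans st.
- exact: disj_itv0c_itvoc.
Qed.

Lemma Rintegral_sub_itv0c_shift (s t : R) : 0 <= s ->
  \int[mu]_(x in `[0, s]) (t - x) =
  \int[mu]_(x in `[0, s]) (s - x) + (t - s) * H s.
Proof.
move=> s0; have -> : H s = fine (mu `[0, s]%classic) by rewrite muH.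
rewrite -Rintegral_cst// -RintegralD//=.
- by apply: eq_Rintegral => x _; ring.
- exact: integrable_sub_itv0c.
- apply: measurable_bounded_integrable => //.
    by rewrite muH// ltry.
  exact: bounded_cst.
Qed.

(** The integrand lies between [0] and [t - s] on []s, t]], a set of mass [H t - H s]. *)
Lemma Rintegral_sub_itvoc_bounds (s t : R) : 0 <= s -> s <= t ->
  0 <= \int[mu]_(x in `]s, t]) (t - x) <= (t - s) * (H t - H s).
Proof.
move=> s0 st; apply/andP; split.
  apply: Rintegral_ge0 => x /=; rewrite in_itv/= => /andP[_ xt].
  by rewrite subr_ge0.
have -> : H t - H s = fine (mu `]s, t]%classic) by rewrite measure_itvoc_diff.
rewrite -Rintegral_cst//.
apply: le_Rintegral; first exact: measurable_itv.
- apply: (integrableS _ _ _ (integrable_sub_itv0c t t (le_trans s0 st))).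
  + exact: measurable_itv.
  + exact: measurable_itv.
  + by apply: subset_itv; rewrite bnd_simp.
- apply: measurable_bounded_integrable => //.
    by rewrite measure_itvoc_diff// ltry.
  exact: bounded_cst.
- move=> x /=; rewrite in_itv/= => /andP[sx _]; rewrite lerD2l lerN2.
  exact: ltW.
Qed.

Lemma Rintegral_sub_itv0c_subgradient (s t : R) : 0 <= s -> 0 <= t ->
  H s * (t - s) <=
  \int[mu]_(x in `[0, t]) (t - x) - \int[mu]_(x in `[0, s]) (s - x).
Proof.
move=> s0 t0; have [st|/ltW ts] := leP s t.
(* The difference of the integrals is [(t - s) * H s] plus the integral over []s, t]], which is
   non-negative. *)
- have /andP[ge0 _] := Rintegral_sub_itvoc_bounds s t s0 st.
  rewrite (Rintegral_sub_itv0cD s t t s0 st) Rintegral_sub_itv0c_shift//; lra.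
(* With the roles swapped, the opposite difference is [(s - t) * H t] plus at most
   [(s - t) * (H s - H t)], hence at most [(s - t) * H s]. *)
- have /andP[_ le] := Rintegral_sub_itvoc_bounds t s t0 ts.
  rewrite (Rintegral_sub_itv0cD t s s t0 ts) (Rintegral_sub_itv0c_shift t s t0).
  nra.
Qed.

End Rintegral_sub.

(** The two bounds are the subgradient inequalities at [x] and at [z]. They squeeze the difference
    quotient between [c x] and [c z], and [c z] tends to [c x]. *)
Lemma is_derive_subgradient (R : realType) (f c : R -> R) (x : R) :
  {for x, continuous c} ->
  (\forall z \near x, c x * (z - x) <= f z - f x <= c z * (z - x)) ->
  is_derive x 1 f (c x).
Proof.
move=> cx fx; apply/is_derive1_caratheodory.
(* The Carathéodory slope function: the difference quotient, completed by [c x] at [x]. *)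
exists (fun z => if z == x then c x else (f z - f x) / (z - x)); split.
- move=> z; case: eqP => [->|/eqP zx]; first by rewrite !subrr mulr0.
  by rewrite divfK// subr_eq0.
- apply/cvgrPdist_le => e e0 /=; rewrite eqxx.
  near=> z; case: eqP => [_|/eqP zx]; first by rewrite subrr normr0 ltW.
  have cze : `|c x - c z| <= e.
    by near: z; move/cvgrPdist_le : cx; exact.
  have fz : c x * (z - x) <= f z - f x <= c z * (z - x) by near: z.
  apply: le_trans cze; case/andP: fz => lo hi.
  have [xz|zx'] : x < z \/ z < x by move: zx; rewrite neq_lt => /orP[]; tauto.
  + have q1 : c x <= (f z - f x) / (z - x) by rewrite ler_pdivlMr ?subr_gt0.
    have q2 : (f z - f x) / (z - x) <= c z by rewrite ler_pdivrMr ?subr_gt0.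
    rewrite ler0_norm ?subr_le0// ler0_norm ?subr_le0; last exact: le_trans q2.
    lra.
  + have q1 : (f z - f x) / (z - x) <= c x by rewrite ler_ndivrMr ?subr_lt0.
    have q2 : c z <= (f z - f x) / (z - x) by rewrite ler_ndivlMr ?subr_lt0.
    rewrite ger0_norm ?subr_ge0// ger0_norm ?subr_ge0; last exact: le_trans q1.
    lra.
- by rewrite eqxx.
Unshelve. all: by end_near. Qed.

(** Take the subgradient inequalities at the intermediate point [z] towards [x] and [y]; in their
    weighted sum the linear terms cancel. *)
Lemma convex_function_subgradient (R : realType) (D : set R) (f c : R -> R) :
  @convex_set R R^o D ->
  (forall x y, D x -> D y -> c x * (y - x) <= f y - f x) ->
  @convex_function R R^o D f.
Proof.
move=> cD fD p x y xD yD; have := cD x y p xD yD.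
move: xD yD; rewrite !inE !convRE => Dx Dy.
set q : R := p%:num => Dz.
have {Dz} Dz : D (q * x + onem q * y) by [].
change (f (q * x + onem q * y) <= q * f x + onem q * f y).
move: Dz; set z := q * x + _ => Dz.
have q0 : 0 <= q by exact: (ge0 p).
have q1 : 0 <= onem q by rewrite onem_ge0//; exact: (le1 p).
have := fD _ _ Dz Dx; have := fD _ _ Dz Dy.
move=> /(ler_wpM2l q1) fy /(ler_wpM2l q0) fx.
have := lerD fx fy.
have -> : q * (c z * (x - z)) + onem q * (c z * (y - z)) = 0.
  by rewrite /z /onem; ring.
rewrite /onem; lra.
Qed.

Theorem theorem2p2 (R : realType) (d : measure_display) (T : measurableType d)
    (P : probability T R) (X : {RV P >-> R}) (F : cumulative R R)
    (hF : continuous_nonneg_distribution X F)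
    (A1 : R -> R)
    (hA1 : forall t : R, 0 < t -> 0 <= A1 t <= 1) :
  (forall t : R, 0 < t -> A1 t = poverty_gap_ratio F t) <->
  [/\ (* (a) *)
      (derive1 (fun s : R => s * A1 s) t @[t --> +oo] --> (1 : R)) /\
      (exists2 l : R,
         derive1 (fun s : R => s * A1 s) t @[t --> 0^'+] --> l & 0 <= l),
      (* (b) *)
      (forall s t : R, 0 < s -> s <= t -> A1 s <= A1 t) /\
      (forall t : R, 0 < t -> derivable A1 t 1),
      (* (c) *)
      @convex_function R R^o (`]0, +oo[ : set R) (fun t : R => t * A1 t)
    & (* (d) *)
      forall t : R, 0 < t ->
        A1 t = \int[lebesgue_stieltjes_measure F]_(x in `[0, t])
                 ((t - (x : R)) / t)].
Proof.
(* The two integrands agree for [t > 0], so the converse is read off from (d). *)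
have integrandE (t : R) : 0 < t -> poverty_gap_ratio F t =
    \int[lebesgue_stieltjes_measure F]_(x in `[0, t]) ((t - (x : R)) / t).
  by move=> t0; apply: eq_Rintegral => x _; rewrite mulrBl divff// gt_eqF.
split=> [A1E|[_ _ _ A1E] t t0]; last by rewrite A1E// integrandE.
pose mu := lebesgue_stieltjes_measure F.
pose G t := \int[mu]_(x in `[0, t]) (t - x).
have F0 (r : R) : r <= 0 -> F r = 0 by exact: continuous_nonneg_distribution_le0 hF.
have subG (s t : R) : 0 <= s -> 0 <= t -> F s * (t - s) <= G t - G s.
  apply: (Rintegral_sub_itv0c_subgradient mu) => u u0.
  exact: lebesgue_stieltjes_measure_itv0c.
have GE (t : R) : 0 < t -> t * A1 t = G t.
  move=> t0; rewrite A1E// integrandE// RintegralZr//.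
  - by rewrite mulrCA divff ?mulr1// gt_eqF.
  - apply: (integrable_sub_itv0c mu) (ltW t0) => u u0.
    exact: lebesgue_stieltjes_measure_itv0c.
have G0 : G 0 = 0.
  have -> : G 0 = \int[mu]_(x in `[0, 0]) 0.
    apply: eq_Rintegral => x; rewrite inE/= in_itv/= -eq_le => /eqP <-.
    by rewrite subrr.
  by rewrite Rintegral_cst ?mul0r.
have dG (t : R) : 0 < t -> is_derive t 1 (fun s => s * A1 s) (F t).
  (* [s * A1 s] is known to equal [G s] only for [s > 0], which holds near [t]. *)
  move=> t0; apply: (@near_eq_is_derive _ _ _ G).
    by near=> s; rewrite GE//; near: s; exact: lt_nbhsr.
  apply: is_derive_subgradient; first by case: hF => _ + _; exact.
  near=> s; have s0 : 0 < s by near: s; exact: lt_nbhsr.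
  rewrite (subG t s (ltW t0) (ltW s0)) /=.
  have := subG s t (ltW s0) (ltW t0); lra.
have dGE (t : R) : 0 < t -> derive1 (fun s => s * A1 s) t = F t.
  by move=> t0; rewrite derive1E; apply: derive_val; exact: dG.
split.
- split.
    apply: (cvg_trans _ (continuous_nonneg_distribution_cvgy _ _ _ _ _ _ hF)).
    by apply: near_eq_cvg; near=> t; rewrite dGE//; near: t; exact: nbhs_pinfty_gt.
  (* The limit at [0] is [F 0 = 0], by continuity of [F]. *)
  exists 0 => //.
  have F00 : F x @[x --> 0^'+] --> (0 : R).
    have [_ cF _] := hF.
    by rewrite -[X in _ --> X](F0 0)//; exact: cvg_at_right_filter (cF 0).
  apply: (cvg_trans _ F00).
  by apply: near_eq_cvg; near=> t; rewrite dGE//; near: t; exact: nbhs_right_gt.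
- split.
    move=> s t s0 st; have t0 := lt_le_trans s0 st.
    have Gs : G s <= F s * s.
      have := subG s 0 (ltW s0) (lexx 0); rewrite G0; lra.
    have := subG s t (ltW s0) (ltW t0); rewrite -!GE// in Gs * => Gt.
    have As : A1 s <= F s by rewrite -(ler_pM2l s0) [leRHS]mulrC.
    (* [t * A1 t >= s * A1 s + F s * (t - s) >= t * A1 s], the last step by [A1 s <= F s]. *)
    rewrite -(ler_pM2l t0); nra.
  (* Dividing by [s] recovers [A1] from the function whose derivative is known. *)
  move=> t t0; apply: (@near_eq_derivable _ _ _ (fun s : R => s^-1 * (s * A1 s))).
    by near=> s; rewrite mulKf// gt_eqF//; near: s; exact: lt_nbhsr.
  apply: derivableM; last by have [] := dG t t0.
  by apply: derivableV => //; rewrite gt_eqF.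
- apply: (@convex_function_subgradient _ _ _ F) => [x y p|x y].
    by rewrite !inE/= !in_itv/= !andbT; exact: convR_gt0.
  rewrite /= !in_itv/= !andbT => x0 y0.
  by rewrite !GE//; exact: subG (ltW x0) (ltW y0).
- by move=> t t0; rewrite A1E// integrandE.
Unshelve. all: by end_near. Qed.
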